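(* Let $m\in\mathbb{N}$, $m-1<\alpha<m$, let $I=[a,b]$ be a finite or infinite interval and let $\psi\in C[a,b]$ be an increasing function, with continuous derivative $\psi'$, such that $\psi'(x)\neq0$ for all $x\in I$. Assume that $(f_n)_{n=1}^\infty$ is a uniformly convergent sequence of continuous functions on $[a,b]$. Then the fractional integral operator and the limit may be interchanged, i.e. $$ I_{a+}^{\alpha;\psi}\lim_{n\to\infty}f_n(x)=\lim_{n\to\infty}I_{a+}^{\alpha;\psi}f_n(x). $$ In particular, the sequence of functions $\left(I_{a+}^{\alpha;\psi}f_n\right)_{n=1}^\infty$ is uniformly convergent.
   Context: The left-sided fractional integral of order $\alpha>0$ of a function $f$ with respect to $\psi$ is $I_{a+}^{\alpha;\psi}f(x)=\frac{1}{\Gamma(\alpha)}\int_a^x\psi'(t)(\psi(x)-\psi(t))^{\alpha-1}f(t)\,dt$.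
   Formalization: If an endpoint is infinite, ψ and all f_n are assumed continuous on the closed interval of the extended line, i.e. with finite limits there; otherwise uniform convergence can fail (a=0, b=∞, ψ(x)=x, f_n=1/n). Conditions on ψ' are imposed only at finite points. *)

(* Defs.v *)
(* MathComp-Analysis *)
From HB Require Import structures.
From mathcomp Require Import all_boot all_order all_algebra.
From mathcomp Require Import all_classical all_reals all_analysis.
Set Implicit Arguments.
Unset Strict Implicit.
Unset Printing Implicit Defensive.
Import Order.TTheory GRing.Theory Num.Theory.
Import numFieldNormedType.Exports.
Local Open Scope classical_set_scope.
Local Open Scope ring_scope.

(* Closed intervals [a, b], finite or infinite, are intervals of the extended
   real line: a may be -oo and b may be +oo, the endpoints always belong to
   the interval, and C[a, b] is the set of functions continuous for the
   extended-real topology, so a function in C[a, b] has a finite limit at an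
   infinite endpoint. *)

Definition finite_points (R : realType) (A : set (\bar R)) : set R :=
  [set x | A x%:E].

(* Since y tends to x inside finite_points A only, this is the one-sided
   derivative when x is a finite endpoint of the interval A. *)
Definition has_derivative_within (R : realType) (A : set (\bar R))
    (psi : \bar R -> R) (x l : R) : Prop :=
  (psi y%:E - psi x%:E) / (y - x)
    @[y --> within (finite_points A) x^'] --> l.

Definition uniformly_convergent (R : realType) (A : set (\bar R))
    (u : nat -> \bar R -> R) : Prop :=
  exists g : \bar R -> R, {uniform A, u @ \oo --> g}.

(* The integrand is evaluated by powR, for which 0 `^ alpha = 0 when
   alpha != 0; this concerns the single point t = 0 (here) and t = x (below). *)
Definition Gamma (R : realType) (alpha : R) : R :=
  \int[lebesgue_measure]_(t in `[0, +oo[) (t `^ (alpha - 1) * expR (- t)).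

(* dpsi stands for the derivative of psi on the interval. *)
Definition frac_integral (R : realType) (a : \bar R) (alpha : R)
    (psi : \bar R -> R) (dpsi : R -> R) (f : \bar R -> R) (x : \bar R) : R :=
  (Gamma alpha)^-1 *
  \int[lebesgue_measure]_(t in finite_points `[a, x])
     (dpsi t * (psi x - psi t%:E) `^ (alpha - 1) * f t%:E).

(* Main.v *)
Require Import Defs.
From HB Require Import structures.
From mathcomp Require Import all_boot all_order all_algebra.
From mathcomp Require Import all_classical all_reals all_analysis.
From mathcomp Require Import measurable_realfun.
Set Implicit Arguments.
Unset Strict Implicit.
Unset Printing Implicit Defensive.
Import Order.TTheory GRing.Theory Num.Theory.
Import numFieldNormedType.Exports.
Local Open Scope classical_set_scope.
Local Open Scope ring_scope.

(** The kernel [k t = psi' t * (psi x - psi t)^(alpha - 1)] is nonnegative with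
    primitive [- (psi x - psi t)^alpha / alpha], so its integral over [[a, x]] is
    at most [(psi b - psi a)^alpha / alpha], uniformly in [x]. Hence
    [|I g x - I f_n x|] is at most a constant times [sup |g - f_n|]. The continuous
    functions [f_n] are bounded because [[a, b]] is compact in the extended real
    line even when it is infinite. *)

(** * Compactness of closed intervals of the extended real line *)

(** The map [expand], inverse to [contract], carries the compact segment [[-1, 1]] continuously onto
    the extended line. *)
Lemma compact_ereal_setT (R : realType) : compact [set: \bar R].
Proof.
have -> : [set: \bar R] = (@expand R) @` `[-1, 1].
  apply/seteqP; split => x //= _; exists (contract x); last exact: contractK.
  by rewrite /= in_itv/= -ler_norml contract_le1.
apply: continuous_compact; last exact: segment_compact.
apply/subspace_continuousP => x /=; rewrite in_itv/= -ler_norml => x1.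
apply/cvg_ballP => e e0.
rewrite near_withinE; near=> y => /=; rewrite in_itv/= -ler_norml => y1.
(* Distances in [\bar R] are measured after applying [contract], so [expand] is an isometry on
   [[-1, 1]]. *)
change (`|contract (expand x) - contract (expand y)| < e).
rewrite (expandK x1) (expandK y1).
by near: y; exact: cvgr_dist_lt.
Unshelve. all: by end_near. Qed.

Lemma compact_ereal_itvcc (R : realType) (a b : \bar R) :
  compact (`[a, b] : set (\bar R)).
Proof.
apply: (subclosed_compact _ (@compact_ereal_setT R)) => //.
rewrite set_itvE (_ : [set _ | _] = [set x | a <= x]%E `&` [set x | x <= b]%E).
  by apply: closedI; [exact: closed_ereal_le_ereal|exact: closed_ereal_ge_ereal].
by apply/seteqP; split => x /= /andP.
Qed.

(** * Restriction to finite points *)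

Lemma within_continuous_EFin (R : realType) (A : set (\bar R)) (f : \bar R -> R) :
  {within A, continuous f} -> {within finite_points A, continuous (f \o EFin)}.
Proof.
move=> /subspace_continuousP cf; apply/subspace_continuousP => x Ax.
exact: cf Ax.
Qed.

Lemma measurable_finite_points (R : realType) (i : interval (\bar R)) :
  measurable (finite_points [set` i]).
Proof.
rewrite -[X in measurable X]setTI.
apply: (@EFin_measurable R setT measurableT); exact: emeasurable_itv.
Qed.

(** * Exhaustion of open intervals by compact ones *)

(** Treats finite and infinite left endpoints alike; a right endpoint [b] is reached by applying it
    to [- b]. *)
Lemma approx_gt_ereal (R : realType) (a : \bar R) : (a < +oo)%E ->
  exists c : nat -> R, [/\ forall m n, (m <= n)%N -> c n <= c m,
    forall n, (a < (c n)%:E)%E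
    & forall t, (a < t%:E)%E -> exists n, c n <= t].
Proof.
case: a => [a| |] // _.
- exists (fun n => a + n.+1%:R^-1); split => [m n mn|n|t].
  + by rewrite lerD2l lef_pV2 ?posrE// ler_nat.
  + by rewrite lte_fin ltrDl invr_gt0.
  + rewrite lte_fin -subr_gt0 => ta; exists (Num.truncn (t - a)^-1).
    rewrite -lerBrDl -[leRHS]invrK lef_pV2 ?posrE ?invr_gt0//.
    exact/ltW/truncnS_gt.
- exists (fun n => - n%:R); split => [m n mn|n|t _].
  + by rewrite lerN2 ler_nat.
  + exact: ltNyr.
  + exists (Num.truncn (- t)).+1; rewrite lerNl; exact/ltW/truncnS_gt.
Qed.

(** Monotone convergence along compact intervals that exhaust []a, b[]. A bound obtained from the
    fundamental theorem of calculus on compact intervals thus survives a singularity at an endpoint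
    or an infinite endpoint. *)
Lemma ge0_integral_itvoo_le (R : realType) (a b : \bar R) (f : R -> R) (M : \bar R) :
  (0 <= M)%E ->
  measurable_fun (finite_points `]a, b[) f ->
  (forall t : R, (a < t%:E < b)%E -> 0 <= f t) ->
  (forall c d : R, c < d -> (a < c%:E)%E -> (d%:E < b)%E ->
    (\int[lebesgue_measure]_(t in `[c, d]) (f t)%:E <= M)%E) ->
  (\int[lebesgue_measure]_(t in finite_points `]a, b[) (f t)%:E <= M)%E.
Proof.
move=> M0 mf f0 fM.
have [ab|ba] := ltP a b; last first.
  rewrite (_ : finite_points _ = set0) ?integral_set0//.
  by rewrite set_itv_ge ?bnd_simp -?leNgt//; apply/seteqP; split.
have [c [c_mono ac cP]] := approx_gt_ereal (lt_le_trans ab (leey _)).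
(* The numbers [- d n] approach [b] from below. *)
have /approx_gt_ereal[d [d_mono bd dP]] : (- b < +oo)%E.
  by rewrite lteNl; exact: le_lt_trans (leNye a) ab.
pose F n : set R := [set` `[c n, - d n]].
have Fsub n : F n `<=` finite_points `]a, b[.
  move=> t; rewrite /F/= /finite_points/= !in_itv/= => /andP[ct td].
  rewrite (lt_le_trans (ac n)) ?lee_fin//=.
  by rewrite (@le_lt_trans _ _ (- d n)%:E) ?lee_fin// EFinN lteNl.
have -> : finite_points `]a, b[ = \bigcup_n F n.
  apply/seteqP; split => [t|t [n _]]; last exact: Fsub.
  rewrite /finite_points/= in_itv/= => /andP[/cP[m cm] tb].
  have /dP[n dn] : (- b < (- t)%:E)%E by rewrite EFinN lteN2.
  exists (maxn m n) => //; rewrite /F/= in_itv/=.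
  rewrite (le_trans _ cm) ?c_mono ?leq_maxl//= lerNr (le_trans _ dn)//.
  by rewrite d_mono ?leq_maxr.
have F0 n t : F n t -> (0 <= (f t)%:E)%E.
  by move=> /Fsub; rewrite /finite_points/= in_itv/= lee_fin => /f0.
have mF n : measurable_fun (F n) (EFin \o f).
  apply/measurable_EFinP; apply: measurable_funS mf => //.
  exact: measurable_finite_points.
have ndF : nondecreasing_seq F.
  move=> i j mn; apply/subsetPset => t; rewrite /F/= !in_itv/= => /andP[h1 h2].
  by rewrite (le_trans (c_mono _ _ mn))//= (le_trans h2)// lerN2 d_mono.
have cvgF := @ge0_nondecreasing_set_cvg_integral _ (measurableTypeR R) R F
  (EFin \o f) lebesgue_measure ndF (fun=> measurable_itv _) mF F0.
rewrite -(cvg_lim _ cvgF)//; apply: lime_le; first exact: cvgP cvgF.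
(* For small [n] the interval [[c n, - d n]] may be a point or empty; its integral is then [0],
   whence the assumption [0 <= M]. *)
apply: nearW => n; rewrite /F; have [cd|] := ltP (c n) (- d n).
  by apply: fM => //; rewrite EFinN lteNl.
rewrite le_eqVlt => /predU1P[->|dc]; first by rewrite set_itv1 integral_set1.
by rewrite set_itv_ge ?bnd_simp -?ltNge// integral_set0.
Qed.

(** * Derivatives at interior points and of real powers *)

(** Near an interior point the restriction to [finite_points A] is void, and [y = h + x] turns one
    difference quotient into the other. *)
Lemma is_derive_interior (R : realType) (A : set (\bar R)) (psi : \bar R -> R)
    (x l : R) : nbhs x (finite_points A) ->
  has_derivative_within A psi x l -> is_derive x 1 (psi \o EFin) l.
Proof.
move=> nA dpsi.
suff dF : h^-1 *: ((psi \o EFin \o shift x) (h *: (1 : R)) - (psi \o EFin) x)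
    @[h --> 0^'] --> l.
  by apply: DeriveDef; [exact: cvgP dF|exact: cvg_lim dF].
apply/cvgrPdist_lt => e e0.
have : \forall y \near x^', `|l - (psi y%:E - psi x%:E) / (y - x)| < e.
  have /cvgrPdist_lt/(_ e e0) := dpsi.
  rewrite near_withinE => dpsie.
  have nA' : \forall y \near x^', finite_points A y by exact: nbhs_dnbhs.
  by apply: filterS2 dpsie nA' => y; apply.
move=> /nbhs_ballP[d d0 dP]; apply/nbhs_ballP; exists d => // h.
rewrite /ball/= sub0r normrN => hd h0.
have := dP (h + x).
rewrite /ball/= opprD addrCA subrr addr0 normrN -(inj_eq (addIr (- x))) addrK subrr.
by rewrite [h *: 1]mulr1 [_ *: _]mulrC; apply.
Qed.

Lemma is_derive_powR (R : realType) (x a : R) : 0 < x ->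
  is_derive x 1 (@powR R ^~ a) (a * x `^ (a - 1)).
Proof.
move=> x0; have x0y : x \in `]0, +oo[ by rewrite in_itv/= x0.
by apply: DeriveDef; [exact: derivable_powR|rewrite -derive1E powR_derive1].
Qed.

Lemma continuous_powR (R : realType) (a x : R) : 0 < x ->
  {for x, continuous (@powR R ^~ a)}.
Proof.
move=> x0; apply/differentiable_continuous/derivable1_diffP.
by have [] := is_derive_powR a x0.
Qed.

(** * The integral of the kernel over an open interval *)

Lemma integral_kernel_le (R : realType) (alpha L s : R) (a b : \bar R) (u du : R -> R) :
  0 < alpha ->
  (forall t : R, (a < t%:E < b)%E -> L <= u t < s) ->
  (forall t : R, (a < t%:E < b)%E -> is_derive t 1 u (du t)) ->
  (forall t : R, (a < t%:E < b)%E -> {for t, continuous du}) ->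
  (forall t : R, (a < t%:E < b)%E -> 0 <= du t) ->
  (\int[lebesgue_measure]_(t in finite_points `]a, b[)
     (du t * (s - u t) `^ (alpha - 1))%:E <= ((s - L) `^ alpha / alpha)%:E)%E.
Proof.
move=> alpha0 uLs udu cdu du0.
(* [F] is a primitive of the kernel, of total increase [(s - L)^alpha / alpha]
   at most; the kernel may blow up at [b], hence the exhaustion by compact
   intervals. *)
pose k t := du t * (s - u t) `^ (alpha - 1).
pose F t := - ((s - u t) `^ alpha / alpha).
have dF t : (a < t%:E < b)%E -> is_derive t 1 F (k t).
  move=> abt; have /andP[_ us] := uLs _ abt.
  have du_t := udu _ abt.
  have dsu : is_derive t 1 (fun z => s - u z) (0 - du t) by exact: is_deriveB.
  (* The strict bound [u t < s] keeps the base positive, where [powR] is differentiable for every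
     exponent. *)
  have su0 : 0 < s - u t by rewrite subr_gt0.
  have dcomp := @is_derive1_comp _ (@powR R ^~ alpha) (fun z => s - u z) t _ _
    (is_derive_powR alpha su0) dsu.
  rewrite (_ : F = (- alpha^-1) \*: (fun z => (s - u z) `^ alpha)); last first.
    by apply/funext => z; rewrite /F/= scaleNr mulrC.
  rewrite (_ : k t = (- alpha^-1) *: (alpha * (s - u t) `^ (alpha - 1) * (0 - du t))).
    exact: is_deriveZ.
  rewrite sub0r mulrN scalerN scaleNr opprK -[_ *: _]/(_ * _) !mulrA mulVf ?gt_eqF//.
  by rewrite mul1r mulrC.
have ck t : (a < t%:E < b)%E -> {for t, continuous k}.
  move=> abt; have /andP[_ us] := uLs _ abt.
  apply: cvgM; first exact: cdu.
  apply: (@continuous_comp _ _ _ (fun z => s - u z) (@powR R ^~ (alpha - 1))).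
    apply: cvgB; first exact: cvg_cst.
    by apply/differentiable_continuous/derivable1_diffP; have [] := udu _ abt.
  by apply: continuous_powR; rewrite subr_gt0.
apply: (@ge0_integral_itvoo_le _ a b k).
- by rewrite lee_fin divr_ge0 ?powR_ge0// ltW.
- apply: subspace_continuous_measurable_fun; first exact: measurable_finite_points.
  apply: continuous_in_subspaceT => t; rewrite inE /finite_points/= in_itv/=.
  exact: ck.
- by move=> t abt; rewrite mulr_ge0 ?powR_ge0// du0.
- move=> c d cd ac db.
  have abP t : c <= t <= d -> (a < t%:E < b)%E.
    move=> /andP[ct td]; rewrite (lt_le_trans ac) ?lee_fin//=.
    by rewrite (le_lt_trans _ db) ?lee_fin.
  have cF t : c <= t <= d -> {for t, continuous F}.
    by move=> /abP/dF[dFt _]; exact/differentiable_continuous/derivable1_diffP.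
  rewrite (@continuous_FTC2 _ _ F)//.
  (* [F d - F c] is [(s - u c)^alpha / alpha] minus a nonnegative term, which is dropped; then
     [L <= u c] is used. *)
  + rewrite -EFinB lee_fin /F opprK [leLHS]addrC.
    have /andP[Lc cs] : L <= u c < s by apply: uLs; apply: abP; rewrite lexx ltW.
    rewrite lerBlDr (@le_trans _ _ ((s - L) `^ alpha / alpha))//; last first.
      by rewrite lerDl divr_ge0 ?powR_ge0// ltW.
    rewrite ler_pM2r ?invr_gt0// ge0_ler_powR ?nnegrE ?subr_ge0 ?(ltW alpha0)//.
    * exact: ltW.
    * exact: le_trans (ltW cs).
    * by rewrite lerB.
  + apply: continuous_in_subspaceT => t; rewrite inE/= in_itv/= => /abP.
    exact: ck.
  + split.
    * by move=> t; rewrite in_itv/= => /andP[/ltW ct /ltW td];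
        have [] := dF t (abP _ (introT andP (conj ct td))).
    * by apply: cvg_at_right_filter; apply: cF; rewrite lexx ltW.
    * by apply: cvg_at_left_filter; apply: cF; rewrite lexx ltW.
  + move=> t; rewrite in_itv/= => /andP[/ltW ct /ltW td].
    by rewrite derive1E; have [] := dF t (abP _ (introT andP (conj ct td))).
Qed.

(** * Uniform convergence, boundedness, and comparison of weighted integrals *)

Lemma uniform_cvgP (R : realType) (U : choiceType) (A : set U)
    (u : nat -> U -> R) (g : U -> R) :
  {uniform A, u @ \oo --> g} <->
  forall e, 0 < e -> \forall n \near \oo, forall x, A x -> `|g x - u n x| < e.
Proof.
split=> [ug e e0|ug P /uniform_nbhs[E [entE EP]]].
  apply: (ug [set h | forall x, A x -> `|g x - h x| < e]); apply/uniform_nbhs.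
  exists [set xy : R * R | ball xy.1 e xy.2]; split => //.
  exact: entourage_ball (PosNum e0).
move: entE; rewrite -entourage_ballE => -[e /= e0 eE].
have := ug e e0; apply: filterS => n un; apply: EP => x Ax.
by apply: eE; exact: un.
Qed.

Lemma bounded_within_itvcc (R : realType) (a b : \bar R) (f : \bar R -> R) :
  {within `[a, b], continuous f} ->
  exists C, forall t, t \in `[a, b] -> `|f t| <= C.
Proof.
move=> cf.
have /compact_bounded[M [_ fM]] := continuous_compact cf (@compact_ereal_itvcc R a b).
by exists (M + 1) => t tab; apply: (fM (M + 1)); [rewrite ltrDl|exists t].
Qed.

(** The difference is at most the [L^1] norm of [k] times the sup distance of [f] and [g]. The bound
    [C] serves to make both products integrable, so that their integrals may be subtracted; it does
    not enter the estimate. *)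
Lemma dist_Rintegral_kernel d (T : measurableType d) (R : realType)
    (mu : {measure set T -> \bar R}) (D : set T) (k f g : T -> R) (M C e : R) :
  measurable D -> mu.-integrable D (EFin \o k) ->
  (\int[mu]_(t in D) `|k t|%:E <= M%:E)%E ->
  measurable_fun D f -> measurable_fun D g ->
  (forall t, D t -> `|f t| <= C) -> (forall t, D t -> `|g t| <= C) ->
  (forall t, D t -> `|f t - g t| <= e) ->
  0 <= e ->
  `|\int[mu]_(t in D) (k t * f t) - \int[mu]_(t in D) (k t * g t)| <= M * e.
Proof.
move=> mD ik kM mf mg fC gC fge e0.
have ikM (h : T -> R) : measurable_fun D h -> (forall t, D t -> `|h t| <= C) ->
    mu.-integrable D (EFin \o (fun t => k t * h t)).
  move=> mh hC; rewrite (_ : _ \o _ = ((EFin \o k) \* (EFin \o h))%E); last first.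
    by apply/funext => t /=; rewrite EFinM.
  apply: integrableMl => //; exists C; split; first exact: num_real.
  by move=> x Cx t Dt; exact: le_trans (hC _ Dt) (ltW Cx).
have ikf := ikM _ mf fC; have ikg := ikM _ mg gC.
have ikabs : mu.-integrable D (EFin \o (fun t => `|k t|)).
  by have := integrable_abse ik.
have ikfg : mu.-integrable D (EFin \o (fun t => k t * f t - k t * g t)).
  by have := integrableB mD ikf ikg.
rewrite -RintegralB//; apply: le_trans (le_normr_Rintegral mD ikfg) _.
have ikfg' : mu.-integrable D (EFin \o (fun t => `|k t * f t - k t * g t|)).
  by have := integrable_abse ikfg.
apply: (@le_trans _ _ (\int[mu]_(t in D) (`|k t| * e))).
  apply: le_Rintegral => //.
    by have := integrableZr mD e ikabs.
  by move=> t Dt; rewrite -mulrBr normrM ler_wpM2l// fge.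
rewrite RintegralZr// ler_wpM2r// -lee_fin fineK//.
exact: integrable_fin_num.
Qed.

(** * Integrability of the fractional kernel *)

(** If [l < 0], the difference quotients near [t] would be negative, yet those of an increasing
    function are not. Interiority of [t] supplies a point [y != t] of [A] at which the two clash. *)
Lemma derivative_within_ge0 (R : realType) (A : set (\bar R)) (psi : \bar R -> R)
    (t l : R) : nbhs t (finite_points A) ->
  (forall y z, A y -> A z -> (y < z)%E -> psi y < psi z) ->
  has_derivative_within A psi t l -> 0 <= l.
Proof.
move=> nA psi_incr dpsi; rewrite leNgt; apply/negP => l0.
have : \forall y \near t^', (psi y%:E - psi t%:E) / (y - t) < 0.
  have /cvgr_lt/(_ _ l0) := dpsi.
  rewrite near_withinE => q0.
  have nA' : \forall y \near t^', finite_points A y by exact: nbhs_dnbhs.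
  by apply: filterS2 q0 nA' => y; apply.
have nA' : \forall y \near t^', finite_points A y /\ y != t.
  apply: filterI; first exact: nbhs_dnbhs.
  exact: withinT.
move=> q_lt0; have [y [+ [Ay yt]]] :=
  filter_ex (FF := Proper_dnbhs_numFieldType t) (filterI q_lt0 nA').
apply/negP.
have At : A t%:E := nbhs_singleton nA.
rewrite -leNgt; move: yt; rewrite neq_lt => /orP[yt|ty].
  rewrite -mulrNN -invrN !opprB divr_ge0// subr_ge0 ltW//.
  by apply: psi_incr; rewrite ?lte_fin.
by rewrite divr_ge0// subr_ge0 ltW//; apply: psi_incr; rewrite ?lte_fin.
Qed.

(** On the open interval [integral_kernel_le] applies with [u = psi], [L = psi a] and [s = psi x],
    and the endpoints form a null set. Passing from [psi x] to [psi b] makes the bound independent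
    of [x], as uniform convergence requires. *)
Lemma integrable_frac_kernel (R : realType) (alpha : R) (a b x : \bar R)
    (psi : \bar R -> R) (dpsi : R -> R) :
  0 < alpha -> x \in `[a, b] ->
  {within `[a, b], continuous psi} ->
  {in `[a, b] &, {homo psi : y z / (y < z)%E >-> y < z}} ->
  (forall t : R, finite_points `[a, b] t ->
     has_derivative_within `[a, b] psi t (dpsi t)) ->
  {within finite_points `[a, b], continuous dpsi} ->
  let k t := dpsi t * (psi x - psi t%:E) `^ (alpha - 1) in
  lebesgue_measure.-integrable (finite_points `[a, x]) (EFin \o k) /\
  (\int[lebesgue_measure]_(t in finite_points `[a, x]) `|k t|%:E <=
    ((psi b - psi a) `^ alpha / alpha)%:E)%E.
Proof.
move=> alpha0 xab cpsi ipsi dpsiE cdpsi k.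
have /andP[ax xb] : (a <= x <= b)%E by move: xab; rewrite in_itv.
have le_psi y z : (a <= y)%E -> (z <= b)%E -> (y <= z)%E -> psi y <= psi z.
  move=> ay zb; rewrite le_eqVlt => /predU1P[->//|yz].
  rewrite ltW// ipsi// in_itv/= ?ay ?zb ?andbT.
    exact: le_trans (ltW yz) zb.
  exact: le_trans ay (ltW yz).
pose D := finite_points `[a, x].
have Dab : D `<=` finite_points `[a, b].
  move=> t; rewrite /D /finite_points/= !in_itv/= => /andP[->/= tx].
  exact: le_trans xb.
have mD : measurable D := measurable_finite_points _.
have mab : measurable (finite_points `[a, b]) := measurable_finite_points _.
have mk : measurable_fun D k.
  apply: (measurable_funS mab Dab); apply: measurable_funM.
    exact: subspace_continuous_measurable_fun.
  apply: (measurableT_comp (measurable_powR _)); apply: measurable_funB => //.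
  exact: subspace_continuous_measurable_fun (within_continuous_EFin cpsi).
(* Strictly between [a] and [x], derivatives and continuity within the interval become two-sided. *)
have interior t : (a < t%:E < x)%E -> nbhs t (finite_points `[a, b]).
  move=> /andP[at_ tx]; apply: (nbhs_interval at_ tx) => y ay yx.
  by rewrite /finite_points/= in_itv/= (ltW ay) (le_trans (ltW yx)).
have dpsi0 t : (a < t%:E < x)%E -> 0 <= dpsi t.
  move=> /interior nt; apply: (derivative_within_ge0 nt).
    by move=> y z; exact: ipsi.
  exact/dpsiE/(nbhs_singleton nt).
have intk : (\int[lebesgue_measure]_(t in finite_points `]a, x[) `|k t|%:E <=
    ((psi b - psi a) `^ alpha / alpha)%:E)%E.
  rewrite (@eq_integral _ (measurableTypeR R) _ _ _ (fun t => (k t)%:E)); last first.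
    move=> t; rewrite inE /finite_points/= in_itv/= => /dpsi0 dpsit.
    by rewrite ger0_norm// mulr_ge0 ?powR_ge0.
  apply: (@le_trans _ _ ((psi x - psi a) `^ alpha / alpha)%:E); last first.
    rewrite lee_fin ler_pM2r ?invr_gt0// ge0_ler_powR ?nnegrE ?subr_ge0 ?(ltW alpha0)//.
    - exact: le_psi.
    - by apply: le_psi => //; exact: le_trans ax xb.
    - by rewrite lerB// le_psi.
  apply: (@integral_kernel_le _ _ _ _ a x (psi \o EFin)) => //.
  - move=> t /andP[at_ tx]; rewrite /= le_psi ?(ltW at_)//=; last first.
      exact: le_trans (ltW tx) xb.
    rewrite ipsi// in_itv/= ?ax ?(ltW at_) ?xb//=.
    exact: le_trans (ltW tx) xb.
  - move=> t /interior nt; apply: (is_derive_interior nt).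
    exact/dpsiE/(nbhs_singleton nt).
  - move=> t /interior nt; have tab := nbhs_singleton nt.
    move/subspace_continuousP : cdpsi => /(_ t tab).
    by rewrite /continuous_at within_interior.
have intD : (\int[lebesgue_measure]_(t in D) `|k t|%:E <=
    ((psi b - psi a) `^ alpha / alpha)%:E)%E.
  have mabsk : measurable_fun D (fun t => `|k t|%:E).
    by apply/measurable_EFinP/measurableT_comp.
  (* If [a] or [x] is infinite then its [fine] is [0], a harmless extra point. *)
  pose N : set R := [set fine a] `|` [set fine x].
  have mN : measurable N by exact: measurableU.
  rewrite (@ge0_negligible_integral _ (measurableTypeR R) _ _ D N)//; last first.
    apply/eqP; rewrite -measure_le0; apply: le_trans (measureU2 _ _ _) _ => //.
    by rewrite /= !lebesgue_measure_set1 adde0.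
  apply: le_trans intk; apply: ge0_subset_integral => //.
  - exact: measurableD.
  - exact: measurable_finite_points.
  - apply: measurable_funS mabsk => //.
    by move=> t; rewrite /D /finite_points/= !in_itv/= => /andP[/ltW-> /ltW->].
  - move=> t [+ /not_orP[/eqP ta /eqP tx]].
    rewrite /D /finite_points/= !in_itv/= !le_eqVlt => /andP[/predU1P[ta'|->]].
      by move: ta; rewrite ta' eqxx.
    by move=> /predU1P[tx'|//]; move: tx; rewrite -tx' eqxx.
split => //; apply/integrableP; split; first exact/measurable_EFinP.
by apply: le_lt_trans intD _; rewrite ltry.
Qed.

(** * Interchange of the limit and the fractional integral *)

Theorem theorem9 (R : realType) (m : nat) (alpha : R) (a b : \bar R)
    (psi : \bar R -> R) (dpsi : R -> R) (f_ : nat -> \bar R -> R)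
    (hm : (0 < m)%N)
    (halpha : m%:R - 1 < alpha < m%:R)
    (hab : (a < b)%E)
    (psi_cont : {within `[a, b], continuous psi})
    (psi_incr : {in `[a, b] &, {homo psi : x y / (x < y)%E >-> x < y}})
    (psi_deriv : forall x : R, finite_points `[a, b] x ->
       has_derivative_within `[a, b] psi x (dpsi x))
    (dpsi_cont : {within finite_points `[a, b], continuous dpsi})
    (dpsi_neq0 : forall x : R, finite_points `[a, b] x -> dpsi x != 0)
    (f_cont : forall n : nat, {within `[a, b], continuous (f_ n)})
    (f_unif : uniformly_convergent `[a, b] f_) :
  (forall x : \bar R, x \in `[a, b] ->
     cvgn (fun n => frac_integral a alpha psi dpsi (f_ n) x) /\
     frac_integral a alpha psi dpsi (fun t => limn (fun n => f_ n t)) x =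
     limn (fun n => frac_integral a alpha psi dpsi (f_ n) x)) /\
  uniformly_convergent `[a, b]
    (fun n => frac_integral a alpha psi dpsi (f_ n)).
Proof.
have alpha0 : 0 < alpha.
  by move: halpha => /andP[+ _]; apply: le_lt_trans; rewrite subr_ge0 ler1n.
have [g /uniform_cvgP fg] := f_unif.
have fgE t : t \in `[a, b] -> f_ ^~ t @ \oo --> g t.
  move=> tab; apply/cvgrPdist_lt => e e0.
  by apply: filterS (fg e e0) => n; apply.
(* Some bounded [f_ n] lies within [1] of [g]. *)
have [Cg gC] : exists C, forall t, t \in `[a, b] -> `|g t| <= C.
  have /filter_ex[n fgn] := fg 1 ltr01.
  have [C fC] := bounded_within_itvcc (@f_cont n).
  exists (1 + C) => t tab; rewrite -(subrK (f_ n t) (g t)).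
  by rewrite (le_trans (ler_normD _ _))// lerD ?fC// ltW// fgn.
have mab : measurable (finite_points `[a, b]) := measurable_finite_points _.
have mf n : measurable_fun (finite_points `[a, b]) (f_ n \o EFin).
  exact: subspace_continuous_measurable_fun (within_continuous_EFin (@f_cont n)).
have mg : measurable_fun (finite_points `[a, b]) (g \o EFin).
  by apply: (@measurable_fun_cvg _ _ _ _ (fun n => f_ n \o EFin)) => // t; exact: fgE.
pose M := (psi b - psi a) `^ alpha / alpha.
have M0 : 0 <= M by rewrite divr_ge0 ?powR_ge0// ltW.
(* The factor [M] does not depend on [x], so closeness of [f_ n] to [g] passes to the fractional
   integrals uniformly in [x]. *)
have If_close n x e : x \in `[a, b] -> 0 <= e ->
    (forall t, t \in `[a, b] -> `|g t - f_ n t| <= e) ->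
    `|frac_integral a alpha psi dpsi g x - frac_integral a alpha psi dpsi (f_ n) x|
      <= `|(Gamma alpha)^-1| * (M * e).
  move=> xab e0 fge.
  have [C fC] := bounded_within_itvcc (@f_cont n).
  have Dab : finite_points `[a, x] `<=` finite_points `[a, b].
    move: xab; rewrite in_itv/= => /andP[_ xb] t.
    rewrite /finite_points/= !in_itv/= => /andP[->/= tx]; exact: le_trans xb.
  have [ik kM] := integrable_frac_kernel alpha0 xab psi_cont psi_incr psi_deriv dpsi_cont.
  rewrite /frac_integral -mulrBr normrM ler_wpM2l//.
  apply: (dist_Rintegral_kernel (C := Num.max Cg C) _ ik kM) => //.
  - exact: measurable_finite_points.
  - exact: (measurable_funS mab Dab mg).
  - exact: (measurable_funS mab Dab (mf n)).
  - by move=> t /Dab tab; rewrite le_max gC.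
  - by move=> t /Dab tab; rewrite le_max fC ?orbT.
  - by move=> t /Dab; exact: fge.
have If_unif e : 0 < e -> \forall n \near \oo, forall x, x \in `[a, b] ->
    `|frac_integral a alpha psi dpsi g x - frac_integral a alpha psi dpsi (f_ n) x| < e.
  move=> e0; pose K := `|(Gamma alpha)^-1| * M.
  have K0 : 0 <= K by rewrite mulr_ge0.
  (* Only [0 <= K] is available, so [K + 1] avoids dividing by [0] and also makes the final
     inequality strict. *)
  have eK : 0 < e / (K + 1) by rewrite divr_gt0// ltr_wpDl.
  apply: filterS (fg _ eK) => n fgn x xab.
  apply: le_lt_trans (If_close n x _ xab (ltW eK) _) _.
    by move=> t tab; exact/ltW/fgn.
  by rewrite mulrA mulrCA gtr_pMr// ltr_pdivrMr ?ltr_wpDl// mul1r ltrDl.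
split; last by exists (frac_integral a alpha psi dpsi g); apply/uniform_cvgP.
move=> x xab.
have If_cvg : frac_integral a alpha psi dpsi (f_ n) x @[n --> \oo] -->
    frac_integral a alpha psi dpsi g x.
  apply/cvgrPdist_lt => e e0.
  by apply: filterS (If_unif e e0) => n; apply.
split; first exact: cvgP If_cvg.
(* It remains to identify the pointwise limit of [f_] with [g] under the integral; they agree on
   [[a, b]], which contains [[a, x]]. *)
rewrite (cvg_lim _ If_cvg)//; congr (_ * _).
apply: eq_Rintegral => t; rewrite inE /finite_points/= !in_itv/= => /andP[at_ tx].
rewrite (cvg_lim _ (fgE t%:E _))// in_itv/= at_/=.
by move: xab; rewrite in_itv/= => /andP[_]; exact: le_trans.
Qed.
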